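(* Assume the overlap satisfies $\kappa>0$ and that the partitioning algorithm described in the context has converged. Then the on-line evaluation complexity of the resulting feasible commutation map $f_\delta$ is $\mathcal{O}(p^3)$.
   Context: Notation: $\mathbb{I}=\{0,1\}$; $\mathbb{B}=\{x\in\mathbb{R}^p:\|x\|_2\le 1\}$; for a set $\mathcal{A}$, $s\mathcal{A}+b=\{sa+b:a\in\mathcal{A}\}$; $\mathcal{S}^{\mathrm{c}}$, $c^{\mathcal{S}}$ and $\mathcal{V}(\mathcal{S})$ denote the complement, barycenter and vertex set of $\mathcal{S}$; $\mathrm{co}$ denotes convex hull. Problem. For a parameter $\theta\in\mathbb{R}^p$ consider the conic mixed-integer program $$(P_\theta)\qquad V^*(\theta)=\min_{x,\delta} f(\theta,x,\delta)\ \text{ s.t. } g(\theta,x,\delta)=0,\ h(\theta,x,\delta)\in\mathcal{K},\ \delta\in\mathbb{I}^m,$$ with $x\in\mathbb{R}^n$, where $f:\mathbb{R}^p\times\mathbb{R}^n\times\mathbb{I}^m\to\mathbb{R}$ is jointly convex in its first two arguments, $g:\mathbb{R}^p\times\mathbb{R}^n\times\mathbb{I}^m\to\mathbb{R}^\ell$ and $h:\mathbb{R}^p\times\mathbb{R}^n\times\mathbb{I}^m\to\mathbb{R}^d$ are affine in their first two arguments (the dependence on $\delta$ may be nonlinear), and $\mathcal{K}\subset\mathbb{R}^d$ is a convex cone that is a Cartesian product of finitely many convex cones. For fixed $\delta$, $(P_\theta^\delta)$ denotes the same problem minimized over $x$ only. $\Theta^*$ is the set of all $\theta\in\mathbb{R}^p$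 for which $(P_\theta)$ is feasible, and $\Theta^*_\delta$ is the set of all $\theta\in\mathbb{R}^p$ for which $(P^\delta_\theta)$ is feasible. $\Theta\subset\mathbb{R}^p$ is a given convex full-dimensional polytope in vertex representation. All problems are assumed appropriately scaled; the suggested scaling is $\max_{\theta\in\Theta}|e_i^{\mathsf{T}}\theta|=1$ for $i=1,\dots,p$, with $e_i$ the standard basis vectors. Overlap. Let $\Delta=\{\delta\in\mathbb{I}^m:\Theta^*_\delta\cap\Theta\neq\emptyset\}$. The overlap $\kappa$ is the largest value $\kappa\in\mathbb{R}_+$ such that for every $\theta\in\Theta$ there exists $\delta\in\Delta$ with $(\kappa\mathbb{B}+\theta)\setminus(\Theta^*\cap\Theta)^{\mathrm{c}}\subseteq\Theta^*_\delta$. Algorithm. Create a tree with root $\Theta$; compute a Delaunay triangulation of $\mathcal{V}(\Theta)$ into $\eta_{\mathrm{o}}$ simplices $\mathcal{S}_i$ and add each $\mathcal{S}_i$ as a child open leaf of the root. While any open leaf exists (leaves are processed in depth-first order), perform one iteration: let $\mathcal{R}$ be the first open leaf. (1) If $(P_\theta)$ is infeasible for $\theta=c^{\mathcal{R}}$, STOP (the algorithm fails). (2) Otherwise, solve the feasibility problem $(V^{\mathcal{R}})$: find $\delta\in\mathbb{I}^m$ and vectors $x_\theta\in\mathbb{R}^n$, $\theta\in\mathcal{V}(\mathcal{R})$, such that $g(\theta,x_\theta,\delta)=0$ and $h(\theta,x_\theta,\delta)\in\mathcal{K}$ for all $\theta\in\mathcal{V}(\mathcal{R})$. If it is feasible,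 with found commutation $\hat\delta$, replace the leaf by the closed leaf $(\mathcal{R},\hat\delta)$. If it is infeasible, choose $(\bar v,\bar v')\in\arg\max_{v,v'\in\mathcal{V}(\mathcal{R})}\|v-v'\|_2$, set $v_{\mathrm{mid}}=(\bar v+\bar v')/2$, and add to $\mathcal{R}$ the two child open leaves $\mathrm{co}\{(\mathcal{V}(\mathcal{R})\setminus\{\bar v\})\cup\{v_{\mathrm{mid}}\}\}$ and $\mathrm{co}\{(\mathcal{V}(\mathcal{R})\setminus\{\bar v'\})\cup\{v_{\mathrm{mid}}\}\}$. The algorithm ''converges'' if it terminates because no open leaves are left. Feasible commutation map. On convergence the closed leaves $(\mathcal{R}_i,\delta_i)$ satisfy $\Theta=\bigcup_i\mathcal{R}_i$ and $\mathcal{R}_i\subseteq\Theta^*_{\delta_i}$, and $f_\delta:\Theta\to\mathbb{I}^m$ is defined by $f_\delta(\theta)=\delta_i$ for $i$ such that $\theta\in\mathcal{R}_i$. It is evaluated on-line by descending the tree from the root, at each level testing membership of $\theta$ in child simplices. The evaluation complexity is the worst-case number of scalar linear (facet) inequalities evaluated, each simplex in $\mathbb{R}^p$ having $p+1$ facets. The asymptotics are in $p$; $\eta_{\mathrm{o}}$, $\kappa$ and the longest edge length of the initial simplices are treated as constants. *)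

(* Defs.v *)
From HB Require Import structures.
From Stdlib Require Import Relation_Operators.
From mathcomp Require Import all_boot all_order all_algebra.
From mathcomp Require Import finmap.
From mathcomp Require Import all_classical all_reals all_analysis.

Set Implicit Arguments.
Unset Strict Implicit.
Unset Printing Implicit Defensive.

Import Order.TTheory GRing.Theory Num.Theory.
Import numFieldNormedType.Exports.

Local Open Scope classical_set_scope.
Local Open Scope ring_scope.

Definition commutation (m : nat) : Type := {ffun 'I_m -> bool}.

Section Geometry.
Variables (R : realType) (p : nat).
Implicit Types (A : set 'rV[R]_p) (V : {fset 'rV[R]_p}).

(* The library norm on matrices is the sup norm, hence this definition. *)
Definition norm2 (x : 'rV[R]_p) : R := Num.sqrt (\sum_i x 0 i ^+ 2).

Definition unit_ball : set 'rV[R]_p := [set x | norm2 x <= 1].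

Definition hull A : set 'rV[R]_p := smallest (@convex_set R 'rV[R]_p) A.

Definition vertices A : set 'rV[R]_p :=
  [set x | A x /\ forall y z (t : R), A y -> A z -> 0 < t < 1 ->
     x = t *: y + (1 - t) *: z -> y = x /\ z = x].

Definition polytope_with_vertices A V : Prop :=
  A = hull [set` V] /\ vertices A = [set` V].

Definition full_dimensional A : Prop := interior A !=set0.

(* A nondegenerate simplex S is encoded by the finite set V of its vertices:
   S = region V and V(S) = [set` V]. *)
Definition region V : set 'rV[R]_p := hull [set` V].

Definition affinely_independent V : Prop :=
  forall w : 'rV[R]_p -> R,
    \sum_(v <- V) w v = 0 -> \sum_(v <- V) w v *: v = 0 ->
    forall v, v \in V -> w v = 0.

Definition full_simplex V : Prop := #|` V|%fset = p.+1 /\ affinely_independent V.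

Definition barycenter V : 'rV[R]_p := (#|` V|%fset%:R)^-1 *: \sum_(v <- V) v.

(* Facets of a simplex, each again encoded by its vertex set. *)
Definition facets V : {fset {fset 'rV[R]_p}} := [fset (V `\ v)%fset | v in V]%fset.

Definition longest_edge (s : seq {fset 'rV[R]_p}) : R :=
  \big[Num.max/0]_(V <- s) \big[Num.max/0]_(v <- V) \big[Num.max/0]_(v' <- V)
    norm2 (v - v').

Definition triangulation V (s : seq {fset 'rV[R]_p}) : Prop :=
  [/\ uniq s,
      forall S, S \in s -> (S `<=` V)%fset /\ full_simplex S,
      \bigcup_(S in [set` s]) region S = hull [set` V] &
      forall S S', S \in s -> S' \in s ->
        region S `&` region S' = region (S `&` S')%fset].

(* No point of V lies strictly inside the circumsphere of a simplex. *)
Definition delaunay V (s : seq {fset 'rV[R]_p}) : Prop :=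
  triangulation V s /\
  forall S, S \in s -> exists (c : 'rV[R]_p) (r : R),
    (forall v, v \in S -> norm2 (v - c) = r) /\
    (forall v, v \in V -> r <= norm2 (v - c)).

End Geometry.

Section Problem.
Variable R : realType.

Definition affine (U W : lmodType R) (F : U -> W) : Prop :=
  forall (t : R) x y, F (t *: x + (1 - t) *: y) = t *: F x + (1 - t) *: F y.

Definition convex_cone (d : nat) (K : set 'rV[R]_d) : Prop :=
  @convex_set R 'rV[R]_d K /\ forall (t : R) x, 0 < t -> K x -> K (t *: x).

(* The conic constraint space R^d is split into [nblocks] coordinate blocks of
   sizes [bdim i], one for each factor of the Cartesian product K. *)
Record problem (p : nat) := Problem {
  nx : nat;
  nbin : nat;
  ncon : nat;
  nblocks : nat;
  bdim : 'I_nblocks -> nat;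
  objective : 'rV[R]_p -> 'rV[R]_nx -> commutation nbin -> R;
  eq_con : 'rV[R]_p -> 'rV[R]_nx -> commutation nbin -> 'rV[R]_ncon;
  conic_con : 'rV[R]_p -> 'rV[R]_nx -> commutation nbin ->
    'rV[R]_(\sum_i bdim i);
  cone_factor : forall i, set 'rV[R]_(bdim i);
  objective_convex : forall delta, @convex_function R ('rV[R]_p * 'rV[R]_nx)%type
    setT (fun z => objective z.1 z.2 delta);
  eq_con_affine : forall delta,
    affine (fun z : 'rV[R]_p * 'rV[R]_nx => eq_con z.1 z.2 delta);
  conic_con_affine : forall delta,
    affine (fun z : 'rV[R]_p * 'rV[R]_nx => conic_con z.1 z.2 delta);
  cone_factor_convex : forall i, convex_cone (@cone_factor i)
}.

Variable p : nat.
Implicit Types (P : problem p) (Theta : set 'rV[R]_p) (V : {fset 'rV[R]_p}).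

Definition cone P : set 'rV[R]_(\sum_i @bdim p P i) :=
  [set y | forall i, @cone_factor p P i (submxrow y i)].

Definition feasible_point P theta (x : 'rV[R]_(nx P))
    (delta : commutation (nbin P)) : Prop :=
  eq_con theta x delta = 0 /\ cone (conic_con theta x delta).

Definition feasible_set_at P (delta : commutation (nbin P)) : set 'rV[R]_p :=
  [set theta | exists x, feasible_point theta x delta].

Definition feasible_set P : set 'rV[R]_p :=
  [set theta | exists x (delta : commutation (nbin P)),
     feasible_point theta x delta].

Definition Delta P Theta : set (commutation (nbin P)) :=
  [set delta | feasible_set_at delta `&` Theta !=set0].

Definition overlap_admissible P Theta (k : R) : Prop :=
  forall theta, Theta theta -> exists2 delta : commutation (nbin P),
    Delta Theta delta &
    [set k *: b + theta | b in @unit_ball R p] `\`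
       ~` (feasible_set P `&` Theta) `<=` feasible_set_at delta.

(* The supremum in the extended reals: it is the largest admissible value
   whenever there is one, and +oo if every k >= 0 is admissible. *)
Definition overlap P Theta : \bar R :=
  ereal_sup [set k%:E | k in [set k : R | 0 <= k /\ overlap_admissible P Theta k]].

(* The problem (V^R) at the simplex with vertex set V, for a given delta. *)
Definition vertex_feasible P V (delta : commutation (nbin P)) : Prop :=
  exists x : 'rV[R]_p -> 'rV[R]_(nx P),
    forall v, v \in V -> feasible_point v (x v) delta.

End Problem.

Section Algorithm.
Variables (R : realType) (p : nat).
Local Notation simplex := {fset 'rV[R]_p}.

Inductive tree (m : nat) : Type :=
| OpenLeaf of simplex
| ClosedLeaf of simplex & commutation m
| Branch of simplex & tree m & tree m.

Definition cell m (t : tree m) : simplex :=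
  match t with OpenLeaf V => V | ClosedLeaf V _ => V | Branch V _ _ => V end.

Fixpoint no_open_leaf m (t : tree m) : bool :=
  match t with
  | OpenLeaf _ => false
  | ClosedLeaf _ _ => true
  | Branch _ l r => no_open_leaf l && no_open_leaf r
  end.

Definition is_longest_edge (V : simplex) (v v' : 'rV[R]_p) : Prop :=
  [/\ v \in V, v' \in V &
      forall u u', u \in V -> u' \in V -> norm2 (u - u') <= norm2 (v - v')].

Definition midpoint (v v' : 'rV[R]_p) : 'rV[R]_p := 2^-1 *: (v + v').

(* One iteration, acting on the first open leaf in depth-first order. When the
   problem is infeasible at the barycenter of that leaf (the STOP case), there
   is no step and the open leaf remains. *)
Inductive step (P : problem R p) : tree (nbin P) -> tree (nbin P) -> Prop :=
| StepClose V delta :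
    feasible_set P (barycenter V) -> vertex_feasible V delta ->
    step (OpenLeaf _ V) (ClosedLeaf V delta)
| StepSplit V v v' :
    feasible_set P (barycenter V) ->
    ~ (exists delta : commutation (nbin P), vertex_feasible V delta) ->
    is_longest_edge V v v' ->
    step (OpenLeaf _ V)
      (Branch V (OpenLeaf _ (midpoint v v' |` (V `\ v))%fset)
                (OpenLeaf _ (midpoint v v' |` (V `\ v'))%fset))
| StepLeft V l l' r : step l l' -> step (Branch V l r) (Branch V l' r)
| StepRight V l r r' :
    no_open_leaf l -> step r r' -> step (Branch V l r) (Branch V l r').

(* The whole tree is represented by the list of the children of its root. *)
Inductive root_step (P : problem R p) :
    seq (tree (nbin P)) -> seq (tree (nbin P)) -> Prop :=
| RootStep s t t' s' :
    all (@no_open_leaf _) s -> step t t' ->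
    root_step (s ++ t :: s') (s ++ t' :: s').

Definition converges_to (P : problem R p) (S0 : seq simplex)
    (T : seq (tree (nbin P))) : Prop :=
  clos_refl_trans _ (@root_step P) [seq OpenLeaf _ V | V <- S0] T /\
  all (@no_open_leaf _) T.

(* On-line evaluation at theta: the value found together with the number of
   facet inequalities evaluated. Siblings are tested in turn until one contains
   theta, and each membership test is charged for all facets of the simplex. *)
Definition test m (theta : 'rV[R]_p) (V : simplex)
    (hit miss : option (commutation m) * nat) : option (commutation m) * nat :=
  let r := if theta \in region V then hit else miss in
  (r.1, (#|` facets V|%fset + r.2)%N).

Fixpoint descend m (theta : 'rV[R]_p) (t : tree m) :
    option (commutation m) * nat :=
  match t with
  | OpenLeaf _ => (None, 0%N)
  | ClosedLeaf _ delta => (Some delta, 0%N)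
  | Branch _ l r =>
      test theta (cell l) (descend theta l)
        (test theta (cell r) (descend theta r) (None, 0%N))
  end.

Definition evaluate m (T : seq (tree m)) (theta : 'rV[R]_p) :
    option (commutation m) * nat :=
  foldr (fun t miss => test theta (cell t) (descend theta t) miss)
    (None, 0%N) T.

Definition commutation_map m (T : seq (tree m)) (theta : 'rV[R]_p) :
    option (commutation m) := (evaluate T theta).1.

Definition evaluation_complexity m (Theta : set 'rV[R]_p) (T : seq (tree m)) :
    \bar R :=
  ereal_sup [set ((evaluate T theta).2%:R)%:E | theta in Theta].

End Algorithm.

(* Main.v *)
Require Import Defs.
From mathcomp Require Import all_boot all_order all_algebra.
From mathcomp Require Import finmap.
From mathcomp Require Import all_classical all_reals all_analysis.
From mathcomp Require Import ring lra zify.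
Import Order.TTheory GRing.Theory Num.Theory.
Import numFieldNormedType.Exports.

Set Implicit Arguments.
Unset Strict Implicit.
Unset Printing Implicit Defensive.

Local Open Scope classical_set_scope.
Local Open Scope ring_scope.

(* A split cell has an edge longer than a fixed [k0 > 0] depending only on
   [kappa]: otherwise the overlap property at one of its vertices yields a
   commutation feasible at all of them, every vertex being feasible because it
   is also a vertex of some closed leaf. On the other hand, bisecting a longest
   edge of squared length at most [D] only creates edges of squared length at
   most [3 D / 4], so along a branch the number of edges of squared length
   above [3 D / 4] strictly decreases, and after at most [(p+1)^2] bisections
   the bound [D] has dropped by a factor [3 / 4]. Hence the tree has depth
   [O(p^2)], and each level costs at most [2 (p + 1)] inequalities. *)

(** * Edge lengths under longest-edge bisection *)

Section Norm.
Variables (R : realType) (p : nat).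
Implicit Types (x y v w : 'rV[R]_p) (V : {fset 'rV[R]_p}) (D : R).

Lemma norm2_ge0 x : 0 <= norm2 x.
Proof. exact: sqrtr_ge0. Qed.

Lemma sqr_norm2 x : norm2 x ^+ 2 = \sum_i x 0 i ^+ 2.
Proof. by rewrite sqr_sqrtr// sumr_ge0// => i _; exact: sqr_ge0. Qed.

Lemma norm2N x : norm2 (- x) = norm2 x.
Proof. by congr Num.sqrt; apply: eq_bigr => i _; rewrite mxE sqrrN. Qed.

Lemma norm2Z (a : R) x : norm2 (a *: x) = `|a| * norm2 x.
Proof.
rewrite /norm2 -sqrtr_sqr -sqrtrM ?sqr_ge0//; congr Num.sqrt.
by rewrite mulr_sumr; apply: eq_bigr => i _; rewrite mxE exprMn.
Qed.

Lemma midpointxx v : midpoint v v = v.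
Proof. by apply/rowP => i; rewrite !mxE; field. Qed.

(** Apollonius' formula for the length of a median. *)
Lemma sqr_norm2_midpoint v w x :
  norm2 (midpoint v w - x) ^+ 2 =
  (norm2 (v - x) ^+ 2 + norm2 (w - x) ^+ 2) / 2 - norm2 (v - w) ^+ 2 / 4.
Proof.
rewrite !sqr_norm2 -big_split /= !mulr_suml -sumrB; apply: eq_bigr => i _.
by rewrite !mxE; field.
Qed.

Definition edges_within V D : Prop :=
  forall u w, u \in V -> w \in V -> norm2 (u - w) ^+ 2 <= D.

(** Ordered pairs, so an edge counts twice; this keeps the bound a plain square of the number of
    vertices. *)
Definition long_edges D V : seq ('rV[R]_p * 'rV[R]_p) :=
  [seq e <- [seq (u, w) | u <- V, w <- V] | D < norm2 (e.1 - e.2) ^+ 2].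

Lemma mem_long_edges D V u w :
  ((u, w) \in long_edges D V) =
  [&& u \in V, w \in V & D < norm2 (u - w) ^+ 2].
Proof.
rewrite mem_filter andbC /= andbA; congr andb; apply/allpairsP/andP.
  by move=> [[a b] /= [aV bV [-> ->]]].
by move=> [uV wV]; exists (u, w).
Qed.

Lemma long_edges_uniq D V : uniq (long_edges D V).
Proof.
by apply/filter_uniq/allpairs_uniq; [exact: fset_uniq..|move=> [? ?] [? ?]].
Qed.

Lemma size_long_edges D V : (size (long_edges D V) <= #|` V|%fset ^ 2)%N.
Proof.
rewrite size_filter (leq_trans (count_size _ _))// size_allpairs.
by rewrite mulnn.
Qed.

Lemma is_longest_edgeC V v w : is_longest_edge V v w -> is_longest_edge V w v.
Proof.
move=> [vV wV vw]; split=> // a b aV bV.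
by rewrite -(norm2N (w - v)) opprB vw.
Qed.

Definition bisect V v w : {fset 'rV[R]_p} := (midpoint v w |` (V `\ v))%fset.

Lemma mem_bisect V v w u :
  (u \in bisect V v w) = (u == midpoint v w) || (u != v) && (u \in V).
Proof. by rewrite !inE. Qed.

Lemma midpointC v w : midpoint v w = midpoint w v.
Proof. by rewrite /midpoint addrC. Qed.

Lemma card_bisect V v w : v \in V -> (#|` bisect V v w| <= #|` V|)%N%fset.
Proof.
by move=> vV; rewrite cardfsU1 [leqRHS](cardfsD1 v) vV leq_add2r leq_b1.
Qed.

Section Bisection.
Variables (V : {fset 'rV[R]_p}) (v w : 'rV[R]_p) (D : R).
Hypotheses (VD : edges_within V D) (vw : is_longest_edge V v w).

Let D_ge0 : 0 <= D.
Proof. by case: vw => vV _ _; exact: le_trans (sqr_ge0 _) (VD vV vV). Qed.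

(** In the median formula both sides are at most the longest edge, which leaves [1 - 1/4] of its
    square. *)
Lemma midpoint_edge u : u \in bisect V v w ->
  norm2 (midpoint v w - u) ^+ 2 <= 3 / 4 * norm2 (v - w) ^+ 2.
Proof.
case: vw => vV wV longest; rewrite mem_bisect => /orP[/eqP ->|/andP[_ uV]].
  rewrite subrr sqr_norm2 big1 => [|i _]; last by rewrite mxE expr0n.
  by have := sqr_ge0 (norm2 (v - w)); lra.
rewrite sqr_norm2_midpoint.
have le a b : a \in V -> b \in V -> norm2 (a - b) ^+ 2 <= norm2 (v - w) ^+ 2.
  by move=> aV bV; rewrite lerXn2r ?nnegrE ?norm2_ge0// longest.
by have := le _ _ vV uV; have := le _ _ wV uV; lra.
Qed.

Lemma edges_within_bisect : edges_within (bisect V v w) D.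
Proof.
have vwD : norm2 (v - w) ^+ 2 <= D by case: vw => vV wV _; exact: VD.
move=> a b aV bV; case: (eqVneq a (midpoint v w)) aV => [-> _|am aV].
  by have := midpoint_edge bV; have := D_ge0; lra.
case: (eqVneq b (midpoint v w)) bV => [-> _|bm bV].
  by have := midpoint_edge aV; rewrite -norm2N opprB; have := D_ge0; lra.
move: aV bV; rewrite !mem_bisect (negPf am) (negPf bm).
by move=> /andP[_ aV] /andP[_ bV]; exact: VD.
Qed.

(** By [midpoint_edge], no long edge of the child touches the midpoint, so each is already an edge
    of [V]; the pair [(v, w)] is lost because [v] is removed. *)
Lemma long_edges_bisect : 3 / 4 * D < norm2 (v - w) ^+ 2 ->
  (size (long_edges (3 / 4 * D) (bisect V v w)) <
   size (long_edges (3 / 4 * D) V))%N.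
Proof.
move=> long; case: (vw) => vV wV _; have vwD := VD vV wV; have D0 := D_ge0.
have short a b : a \in bisect V v w -> b \in bisect V v w ->
    3 / 4 * D < norm2 (a - b) ^+ 2 -> [/\ a != v, a \in V & b \in V].
  move=> aV bV abD; case: (eqVneq a (midpoint v w)) aV => [am _|am aV].
    by have := midpoint_edge bV; rewrite -am; lra.
  case: (eqVneq b (midpoint v w)) bV => [bm _|bm bV].
    by have := midpoint_edge aV; rewrite -bm -norm2N opprB; lra.
  move: aV bV; rewrite !mem_bisect (negPf am) (negPf bm) /=.
  by move=> /andP[] ? ? /andP[].
pose L := long_edges (3 / 4 * D) (bisect V v w).
apply: (@uniq_leq_size _ ((v, w) :: L)) => /=.
  rewrite long_edges_uniq andbT mem_long_edges; apply/and3P => -[vB wB _].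
  by have [] := short _ _ vB wB long; rewrite eqxx.
move=> [a b]; rewrite inE => /orP[/eqP[-> ->]|].
  by rewrite mem_long_edges vV wV.
rewrite !mem_long_edges => /and3P[aB bB abD].
by have [_ -> ->] := short _ _ aB bB abD.
Qed.

End Bisection.

Lemma hull_sub (A : set 'rV[R]_p) : A `<=` hull A.
Proof. exact: sub_gen_smallest. Qed.

Lemma hull_midpoint (A : set 'rV[R]_p) v w :
  hull A v -> hull A w -> hull A (midpoint v w).
Proof.
move=> Av Aw B [cB AB].
have h0 : 0 <= (2^-1 : R) by lra.
have h1 : (2^-1 : R) <= 1 by lra.
have := cB v w (Itv01 h0 h1); rewrite !inE => /(_ (Av B _) (Aw B _)) vwB.
have -> : midpoint v w = conv (Itv01 h0 h1) (v : convex_lmodType 'rV[R]_p) w.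
  by apply/rowP => i; rewrite !mxE /= /unstable.onem; field.
exact: vwB.
Qed.

Lemma edges_within_longest_edge (s : seq {fset 'rV[R]_p}) V :
  V \in s -> edges_within V (longest_edge s ^+ 2).
Proof.
move=> sV u w uV wV.
have le : norm2 (u - w) <= longest_edge s.
  apply: bigmax_sup_seq sV isT _; apply: bigmax_sup_seq uV isT _.
  exact: le_bigmax_seq wV isT.
by rewrite lerXn2r ?nnegrE ?norm2_ge0// (le_trans (norm2_ge0 _) le).
Qed.

End Norm.

(** * Invariants and depth of the bisection tree *)

Section Tree.
Variables (R : realType) (p : nat) (P : problem R p).
Implicit Types (V : {fset 'rV[R]_p}) (t : tree R p (nbin P)) (k D : R).

Fixpoint depth t : nat :=
  match t with
  | Branch _ l r => (maxn (depth l) (depth r)).+1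
  | _ => 0%N
  end.

(** Invariant of the iterations: each closed leaf keeps its certificate, each branch the reason for
    its split and the shape of its children. *)
Fixpoint valid_tree t : Prop :=
  match t with
  | OpenLeaf _ => True
  | ClosedLeaf V delta => vertex_feasible V delta
  | Branch V l r =>
      [/\ ~ (exists delta : commutation (nbin P), vertex_feasible V delta),
          exists v w, [/\ is_longest_edge V v w, cell l = bisect V v w &
                          cell r = bisect V w v],
          valid_tree l & valid_tree r]
  end.

(** Preservation of the cell is what lets the equations on the children's cells, recorded at a
    branch, survive a step further down. *)
Lemma step_valid t t' :
  step t t' -> cell t' = cell t /\ (valid_tree t -> valid_tree t').
Proof.
elim=> {t t'} [V delta _ Vd|V v w _ nf vw|V l l' r _ [cl vl]|V l r r' _ _ [cr vr]];
  split=> //=.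
- by move=> _; split=> //; exists v, w; split=> //; rewrite /bisect midpointC.
- by rewrite cl => -[? ? /vl].
- by rewrite cr => -[? ? ? /vr].
Qed.

Lemma converges_to_valid (S0 : seq {fset 'rV[R]_p})
    (T : seq (tree R p (nbin P))) : converges_to S0 T ->
  size T = size S0 /\
  forall t, List.In t T -> [/\ cell t \in S0, no_open_leaf t & valid_tree t].
Proof.
move=> [reach closed].
pose inv s := map (@cell R p (nbin P)) s = S0 /\ List.Forall valid_tree s.
have [] : inv T.
  have : inv [seq OpenLeaf (nbin P) V | V <- S0].
    split; first by rewrite -map_comp map_id.
    by apply/List.Forall_forall => t /List.in_map_iff[V [<-]].
  elim: reach => {closed} [x y [s t t' s' _ tt']|//|T1 T2 T3 _ IH12 _ IH23 /IH12 //].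
  rewrite /inv !map_cat /= => -[<-].
  move=> /List.Forall_app[vs /List.Forall_cons_iff[vt vs']].
  have [-> vt'] := step_valid tt'; split=> //.
  by apply/List.Forall_app; split=> //; constructor=> //; exact: vt'.
move=> cT /List.Forall_forall vT; split; first by rewrite -cT size_map.
have {}cT : {subset map (@cell R p (nbin P)) T <= S0} by rewrite cT.
elim: T closed vT cT {reach} => //= t T IH /andP[ot oT] vT cT s [<-|].
  by split=> //; [apply/cT/mem_head|apply: vT; left].
apply: IH => // [u uT|V VT]; first by apply: vT; right.
by apply: cT; rewrite inE VT orbT.
Qed.

(** A bisection keeps every vertex in at least one child, so [u] can be followed down to a closed
    leaf, whose certificate covers it. *)
Lemma vertices_feasible t u : valid_tree t -> no_open_leaf t ->
  u \in cell t -> feasible_set P u.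
Proof.
elim: t => [V//|V delta [x Vx] _ uV|V l IHl r IHr].
  by exists (x u), delta; exact: Vx.
move=> /= [_ [v [w [_ cl cr]]] vl vr] /andP[ol or] uV.
case: (eqVneq u v) => [uv|uv].
  (* In the degenerate case [v = w] the removed vertex returns as the midpoint. *)
  case: (eqVneq u w) => [uw|uw].
    by apply: IHl => //; rewrite cl mem_bisect -uv -uw midpointxx eqxx.
  by apply: IHr => //; rewrite cr mem_bisect uw uV orbT.
by apply: IHl => //; rewrite cl mem_bisect uv uV orbT.
Qed.

(** The ball of radius [k] around the vertex [w] contains all of [V], so the commutation that
    overlap provides at [w] serves every vertex. *)
Lemma overlap_vertex_feasible Theta V k w : 0 < k ->
    overlap_admissible P Theta k -> w \in V ->
    (forall u, u \in V -> Theta u) -> (forall u, u \in V -> feasible_set P u) ->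
    edges_within V (k ^+ 2) ->
  exists delta : commutation (nbin P), vertex_feasible V delta.
Proof.
move=> k0 adm wV VT VP Vk; have [delta _ sub] := adm _ (VT _ wV).
exists delta.
have /choice[x xP] : forall u, exists x, u \in V -> feasible_point (P:=P) u x delta.
  move=> u; case: (boolP (u \in V)) => [uV|_]; last by exists 0.
  have [] := sub u; last by move=> x ux; exists x.
  split; last by move/(_ (conj (VP _ uV) (VT _ uV))).
  exists (k^-1 *: (u - w)); last by rewrite scalerA divff ?gt_eqF// scale1r subrK.
  rewrite /unit_ball /= norm2Z gtr0_norm ?invr_gt0// mulrC ler_pdivrMr// mul1r.
  by rewrite -(@ler_pXn2r _ 2) ?nnegrE ?norm2_ge0 ?(ltW k0)//; exact: Vk.
by exists x.
Qed.

(** [K] counts the phases, each shrinking [D] by [3 / 4]; a phase lasts at most [n ^ 2] levels, the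
    initial number of long edges. *)
Lemma depth_bound A k K n D t : 0 < k ->
    overlap_admissible P (hull A) k ->
    valid_tree t -> no_open_leaf t -> (forall u, u \in cell t -> hull A u) ->
    (#|` cell t|%fset <= n)%N ->
    edges_within (cell t) D -> (3 / 4) ^+ K * D <= k ^+ 2 ->
  (depth t <= K * n ^ 2)%N.
Proof.
move=> k0 adm; elim: K D t => [|K IHK] D t vt ot tT tn tD DK.
  (* With no phase left, [D <= k ^+ 2], so a branch would contradict [overlap_vertex_feasible]. *)
  case: t vt ot tT tn tD => //= V l r vt ot VT _ VD.
  have [nf [v [w [[vV _ _] _ _]]] _ _] := vt.
  case: nf; apply: (overlap_vertex_feasible k0 adm vV VT).
    by move=> u uV; exact: (@vertices_feasible (Branch V l r)) vt ot uV.
  move=> a b aV bV; apply: le_trans (VD _ _ aV bV) _.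
  by rewrite expr0 mul1r in DK.
(* Within one phase [D] is fixed and the induction is on the tree, with [m] bounding the long edges
   that remain. *)
suff depth_long m : (size (long_edges (3 / 4 * D) (cell t)) <= m)%N ->
    (depth t <= m + K * n ^ 2)%N.
  rewrite mulSn; apply: depth_long; apply: leq_trans (size_long_edges _ _) _.
  by rewrite leq_sqr.
elim: t m vt ot tT tn tD => //= V l IHl r IHr m vt ot VT Vn VD Vm.
have [nf [v [w [vw cl cr]]] vl vr] := vt.
(* A longest edge that is not long ends the phase: the whole subtree falls under [IHK]. *)
have [vwD|vwD] := ltP (3 / 4 * D) (norm2 (v - w) ^+ 2); last first.
  apply: (leq_trans (IHK (3 / 4 * D) (Branch V l r) vt ot VT Vn _ _)) => /=.
  - move=> a b aV bV; apply: le_trans vwD.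
    by case: vw => _ _ longest; rewrite lerXn2r ?nnegrE ?norm2_ge0// longest.
  - by rewrite mulrA -exprSr.
  - exact: leq_addl.
have wv := is_longest_edgeC vw.
have wvD : 3 / 4 * D < norm2 (w - v) ^+ 2 by rewrite -norm2N opprB.
have /andP[ol or] := ot; have [vV wV _] := vw.
have smaller (s : tree R p (nbin P)) x y :
    is_longest_edge V x y -> 3 / 4 * D < norm2 (x - y) ^+ 2 ->
    cell s = bisect V x y ->
    [/\ forall u, u \in cell s -> hull A u, (#|` cell s|%fset <= n)%N,
        edges_within (cell s) D &
        (size (long_edges (3 / 4 * D) (cell s)) <= m.-1)%N].
  move=> xy xyD ->; have [xV yV _] := xy; split.
  - move=> u; rewrite mem_bisect => /orP[/eqP ->|/andP[_ /VT//]].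
    by apply: hull_midpoint; exact: VT.
  - exact: leq_trans (card_bisect _ xV) Vn.
  - exact: edges_within_bisect.
  - have := long_edges_bisect VD xy xyD; lia.
have [lT ln lD lm] := smaller _ _ _ vw vwD cl.
have [rT rn rD rm] := smaller _ _ _ wv wvD cr.
(* The strict decrease gives [0 < m], so that [m.-1] plus the current level is [m]. *)
have := long_edges_bisect VD vw vwD.
have := IHl _ vl ol lT ln lD lm; have := IHr _ vr or rT rn rD rm; lia.
Qed.

(** * Number of inequalities evaluated *)

Lemma card_facets V : (#|` facets V|%fset <= #|` V|%fset)%N.
Proof. exact: leq_imfset_card. Qed.

Lemma cost_test theta V n a (hit miss : option (commutation (nbin P)) * nat) :
  (#|` V|%fset <= n)%N -> (hit.2 <= a)%N -> (miss.2 <= a)%N ->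
  ((test theta V hit miss).2 <= n + a)%N.
Proof.
move=> Vn h m; rewrite /test /= leq_add ?(leq_trans (card_facets V))//.
by case: ifP.
Qed.

Lemma cost_descend theta t n : valid_tree t -> (#|` cell t|%fset <= n)%N ->
  ((descend theta t).2 <= 2 * n * depth t)%N.
Proof.
elim: t => //= V l IHl r IHr [_ [v [w [[vV wV _] cl cr]]] vl vr] Vn.
have ln : (#|` cell l|%fset <= n)%N by rewrite cl (leq_trans (card_bisect _ vV)).
have rn : (#|` cell r|%fset <= n)%N by rewrite cr (leq_trans (card_bisect _ wV)).
have rc := @cost_test theta (cell r) n (2 * n * depth r)
  (descend theta r) (None, 0%N) rn (IHr vr rn) isT.
(* Bounds what follows the first membership test: a descent to the left, or the second test and a
   descent to the right. *)
pose a := (n + 2 * n * maxn (depth l) (depth r))%N.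
apply: (@leq_trans (n + a)%N); last by rewrite /a; lia.
apply: cost_test => //.
  apply: leq_trans (IHl vl ln) _; rewrite /a; nia.
apply: leq_trans rc _; rewrite /a; nia.
Qed.

(** The scan of the root's children is paid in full, but a hit ends it, so only one descent is
    paid. *)
Lemma cost_evaluate theta (T : seq (tree R p (nbin P))) n d :
  (forall t, List.In t T ->
     [/\ valid_tree t, #|` cell t|%fset <= n & depth t <= d]%N) ->
  ((evaluate T theta).2 <= size T * n + 2 * n * d)%N.
Proof.
elim: T => //= t T IH tT; rewrite mulSn -addnA.
have [vt tn td] := tT t (or_introl erefl).
apply: cost_test => //; last by apply: IH => s sT; apply: tT; right.
apply: leq_trans (cost_descend theta vt tn) _.
by rewrite (leq_trans _ (leq_addl _ _))// leq_mul2l td orbT.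
Qed.

End Tree.

(** * Choice of constants and the cubic bound *)

Lemma geometric_eventually_le (R : realType) (z a e : R) :
  `|z| < 1 -> 0 < e -> exists K : nat, z ^+ K * a <= e.
Proof.
move=> z1 e0; have d0 : 0 < e / (`|a| + 1) by rewrite divr_gt0// ltr_wpDl.
have [N _ /(_ N (leqnn N)) /= zN] :=
  @cvgr0_norm_lt _ _ _ _ _ (GRing.exp z) (cvg_expr z1) _ d0.
exists N; apply: (le_trans (ler_norm _)); rewrite normrM.
have a1 : 0 < `|a| + 1 by rewrite ltr_wpDl.
rewrite ltr_pdivlMr// in zN; apply: le_trans (ltW zN).
by rewrite ler_wpM2l// lerDl.
Qed.

Theorem theorem3 (R : realType) (eta_o : nat) (kappa : \bar R) (L : R)
    (kappa_gt0 : (0 < kappa)%E) :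
  exists2 F : nat -> R^o,
    F =O_\oo (fun p : nat => p%:R ^+ 3 : R^o) &
    forall (p : nat) (P : problem R p) (Theta : set 'rV[R]_p)
        (V : {fset 'rV[R]_p}) (S0 : seq {fset 'rV[R]_p})
        (T : seq (tree R p (nbin P))),
      (0 < p)%N ->
      polytope_with_vertices Theta V -> full_dimensional Theta ->
      delaunay V S0 -> size S0 = eta_o -> longest_edge S0 = L ->
      overlap P Theta = kappa ->
      converges_to S0 T ->
      (evaluation_complexity Theta T <= (F p)%:E)%E.
Proof.
(* A real [k0] strictly below [kappa] also covers [kappa = +oo], and makes [K] and [C] independent
   of [p] and of the problem. *)
have [k0 k0_gt0 k0_kappa] : exists2 k : R, 0 < k & (k%:E < kappa)%E.
  case: kappa kappa_gt0 => [r| |]// ; last by exists 1; rewrite ?ltry.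
  by rewrite lte_fin => r0; exists (r / 2); rewrite ?lte_fin; lra.
have [K KL] : exists K : nat, (3 / 4) ^+ K * L ^+ 2 <= k0 ^+ 2.
  by apply: geometric_eventually_le; rewrite ?exprn_gt0// ger0_norm; lra.
(* From [p.+1 <= 2 * p]: the scan costs at most [2 * eta_o * p], the descent
   [2 * K * p.+1 ^ 3 <= 16 * K * p ^ 3]. The successor makes [C] positive. *)
pose C := (2 * eta_o + 16 * K).+1.
exists (fun p => (C * p ^ 3)%:R).
  apply/eqO_exP; exists C%:R; first by rewrite ltr0n.
  apply: nearW => n; rewrite natrM natrX ger0_norm ?mulr_ge0 ?exprn_ge0//.
  by rewrite ger0_norm ?exprn_ge0.
move=> p P Theta V S0 T p0 [ThetaV _] _ [[_ S0V _ _] _] S0eta S0L kappaE S0T.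
(* The supremum need not be attained, but some admissible [k] exceeds [k0]. *)
have [k [_ adm] k0k] : exists2 k : R, 0 <= k /\ overlap_admissible P Theta k & k0 < k.
  move: k0_kappa; rewrite -kappaE => /ereal_sup_gt[_ [k kP <-]].
  by rewrite lte_fin; exists k.
have k_gt0 : 0 < k by exact: lt_trans k0k.
have [sizeT T_valid] := converges_to_valid S0T.
apply: ge_ereal_sup => _ [theta _ <-]; rewrite lee_fin ler_nat.
have := @cost_evaluate _ _ P theta T p.+1 (K * p.+1 ^ 2)%N.
rewrite sizeT S0eta => cost.
apply: (leq_trans (cost _)); last first.
  have p1 : (p.+1 <= 2 * p)%N by lia.
  have p13 : (p.+1 ^ 3 <= 8 * p ^ 3)%N by rewrite -(expnMn 2 p 3) leq_exp2r.
  have pp3 : (p <= p ^ 3)%N by rewrite -{1}(expn1 p) leq_pexp2l.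
  have -> : (2 * p.+1 * (K * p.+1 ^ 2) = 2 * K * p.+1 ^ 3)%N by ring.
  rewrite /C; nia.
move=> t /T_valid[tS0 ot vt]; have [tV [tcard _]] := S0V _ tS0.
split=> //; first by rewrite tcard.
rewrite ThetaV in adm.
apply: (depth_bound k_gt0 adm vt ot _ _ (D := L ^+ 2)).
- by move=> u ut; apply: hull_sub; exact: (fsubsetP tV).
- by rewrite tcard.
- move=> u w ut wt; rewrite -S0L.
  exact: (edges_within_longest_edge tS0 ut wt).
- by apply: le_trans KL _; rewrite lerXn2r ?nnegrE ?ltW.
Qed.
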